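(* Let $d\in\mathbb{N}$, let $r_d\colon\mathbb{Z}^d\to(0,\infty)$ satisfy $\sum_{\boldsymbol{h}\in\mathbb{Z}^d}r_d(\boldsymbol{h})^{-1}<\infty$, and let $\mathcal{H}_r(\mathbb{T}^d)$ be the associated reproducing kernel Hilbert space. Let $I\subset\mathbb{Z}^d$ and let $\Lambda=\Lambda(\boldsymbol{z}_1,M_1,\ldots,\boldsymbol{z}_L,M_L)$ be a multiple rank-1 lattice such that $I=\bigcup_{\ell=1}^L I_\ell$ (a disjoint union). Then $$\sup_{\|f|\mathcal{H}_r(\mathbb{T}^d)\|\le 1}\|f-\operatorname{S}_I^\Lambda f\,|\,L_\infty(\mathbb{T}^d)\|\le (L+1)\sqrt{\sum_{\boldsymbol{h}\in\mathbb{Z}^d\setminus I}r_d(\boldsymbol{h})^{-1}}.$$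
   Context: $\mathbb{T}\sim[0,1)$ is the torus, and $c_{\boldsymbol{h}}(f)=\int_{\mathbb{T}^d}f(\boldsymbol{x})\mathrm{e}^{-2\pi\mathrm{i}\boldsymbol{h}\cdot\boldsymbol{x}}\,\mathrm{d}\boldsymbol{x}$ are the Fourier coefficients. The space $\mathcal{H}_r(\mathbb{T}^d)$ consists of all $f\in L_1(\mathbb{T}^d)$ with $\|f|\mathcal{H}_r(\mathbb{T}^d)\|=\left(\sum_{\boldsymbol{h}\in\mathbb{Z}^d}r_d(\boldsymbol{h})|c_{\boldsymbol{h}}(f)|^2\right)^{1/2}<\infty$, with inner product $\langle f,g\rangle_d=\sum_{\boldsymbol{h}}c_{\boldsymbol{h}}(f)\overline{c_{\boldsymbol{h}}(g)}r_d(\boldsymbol{h})$ and reproducing kernel $K_d(\boldsymbol{x},\boldsymbol{y})=\sum_{\boldsymbol{h}}\mathrm{e}^{2\pi\mathrm{i}\boldsymbol{h}\cdot(\boldsymbol{x}-\boldsymbol{y})}/r_d(\boldsymbol{h})$. Functions are identified with their continuous representatives $f(\boldsymbol{x})=\sum_{\boldsymbol{h}}c_{\boldsymbol{h}}(f)\mathrm{e}^{2\pi\mathrm{i}\boldsymbol{h}\cdot\boldsymbol{x}}$, and point values refer to these. For $\boldsymbol{z}\in\mathbb{Z}^d$ and $M\in\mathbb{N}$, the rank-1 lattice is $\Lambda(\boldsymbol{z},M)=\{\frac{j}{M}\boldsymbol{z}\bmod\boldsymbol{1}\colon j=0,\ldots,M-1\}\subset\mathbb{T}^d$. For $L\in\mathbb{N}$,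 $\boldsymbol{z}_1,\ldots,\boldsymbol{z}_L\in\mathbb{Z}^d$ and $M_1,\ldots,M_L\in\mathbb{N}$, the multiple rank-1 lattice is $\Lambda(\boldsymbol{z}_1,M_1,\ldots,\boldsymbol{z}_L,M_L)=\bigcup_{\ell=1}^L\Lambda(\boldsymbol{z}_\ell,M_\ell)$. Given $I$ and these parameters, define recursively for $\ell=1,\ldots,L$ the pairwise disjoint sets $$I_\ell=\Big\{\boldsymbol{h}\in I\setminus\bigcup_{j=1}^{\ell-1}I_j\colon \boldsymbol{h}\cdot\boldsymbol{z}_\ell\not\equiv\boldsymbol{k}\cdot\boldsymbol{z}_\ell\ (\mathrm{mod}\ M_\ell)\text{ for all }\boldsymbol{k}\in I\setminus\{\boldsymbol{h}\}\Big\}.$$ The approximant of $f$ is $$\operatorname{S}_I^\Lambda f(\boldsymbol{x})=\sum_{\ell=1}^L\sum_{\boldsymbol{h}\in I_\ell}\hat f_{\boldsymbol{h}}\,\mathrm{e}^{2\pi\mathrm{i}\boldsymbol{h}\cdot\boldsymbol{x}},\qquad \hat f_{\boldsymbol{h}}=\frac{1}{M_\ell}\sum_{j=0}^{M_\ell-1}f\Big(\frac{j\boldsymbol{z}_\ell}{M_\ell}\Big)\mathrm{e}^{-2\pi\mathrm{i}j\,\boldsymbol{h}\cdot\boldsymbol{z}_\ell/M_\ell}\quad\text{for }\boldsymbol{h}\in I_\ell.$$ *)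

(* Defs.v *)
From HB Require Import structures.
From mathcomp Require Import all_boot all_order all_algebra finmap.
From mathcomp Require Import all_classical all_reals all_analysis.
From mathcomp.analysis.showcase Require Import summability.
From mathcomp.real_closed Require Import complex.

Set Implicit Arguments.
Unset Strict Implicit.
Unset Printing Implicit Defensive.
Import Order.TTheory GRing.Theory Num.Theory.
Import numFieldNormedType.Exports.
Local Open Scope classical_set_scope.
Local Open Scope ring_scope.

(* Points of R^d and frequencies in Z^d are tuples; T^d is represented by its
   fundamental domain [0,1)^d.  A function on T^d is a function on R^d whose
   values outside [0,1)^d are irrelevant: they are never evaluated, and
   [torus_measure] below does not charge them. *)
Definition torus (R : realType) (d : nat) : set (d.-tuple R) :=
  [set x | forall i, 0 <= tnth x i < 1].

Definition torus_measure1 (R : realType) : set (measurableTypeR R) -> \bar R :=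
  mrestr (@lebesgue_measure R) (measurable_itv `[0%R, 1%R[).

HB.instance Definition _ (R : realType) := Measure.on (@torus_measure1 R).

Lemma torus_measure1_setT (R : realType) :
  @torus_measure1 R [set: measurableTypeR R] = 1%E.
Proof.
rewrite /torus_measure1 /mrestr setTI.
by rewrite lebesgue_measure_itv/= lte_fin ltr01 oppr0 adde0.
Qed.

HB.instance Definition _ (R : realType) :=
  Measure_isProbability.Build _ _ _ (@torus_measure1 R)
    (@torus_measure1_setT R).

Definition product_probability d1 d2 (T1 : measurableType d1)
    (T2 : measurableType d2) (R : realType)
    (P : probability T1 R) (Q : probability T2 R) : set (T1 * T2) -> \bar R :=
  (P \x Q)%E.

HB.instance Definition _ d1 d2 (T1 : measurableType d1)
    (T2 : measurableType d2) (R : realType)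
    (P : probability T1 R) (Q : probability T2 R) :=
  Measure.on (product_probability P Q).

Lemma product_probability_setT d1 d2 (T1 : measurableType d1)
    (T2 : measurableType d2) (R : realType)
    (P : probability T1 R) (Q : probability T2 R) :
  product_probability P Q [set: T1 * T2] = 1%E.
Proof.
rewrite /product_probability -setXTT product_measure1E//.
by rewrite -[RHS]mule1; congr (_ * _)%E; exact: probability_setT.
Qed.

HB.instance Definition _ d1 d2 (T1 : measurableType d1)
    (T2 : measurableType d2) (R : realType)
    (P : probability T1 R) (Q : probability T2 R) :=
  Measure_isProbability.Build _ _ _ (product_probability P Q)
    (product_probability_setT P Q).

Definition tuple_cons (T : Type) (n : nat) (xs : T * n.-tuple T) :
  n.+1.-tuple T := [tuple of xs.1 :: xs.2].

Lemma measurable_tuple_cons dT (T : measurableType dT) (n : nat) :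
  measurable_fun [set: T * n.-tuple T] (@tuple_cons T n).
Proof. exact: measurable_cons. Qed.

HB.instance Definition _ dT (T : measurableType dT) (n : nat) :=
  isMeasurableFun.Build _ _ _ _ (@tuple_cons T n)
    (@measurable_tuple_cons dT T n).

(* Lebesgue measure on [0,1)^d, seen as a probability on R^d *)
Fixpoint torus_measure (R : realType) (d : nat) :
    probability (d.-tuple (measurableTypeR R)) R :=
  match d return probability (d.-tuple (measurableTypeR R)) R with
  | 0%N => \d_([tuple] : 0.-tuple (measurableTypeR R))
  | n.+1 =>
      distribution
        (product_probability (@torus_measure1 R) (torus_measure R n))
        (@tuple_cons (measurableTypeR R) n)
  end.

Definition cabs (R : realType) (w : R[i]) : R := Normc.normc w.

Definition expi (R : realType) (t : R) : R[i] := Complex (cos t) (sin t).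

Definition zdot (d : nat) (h k : d.-tuple int) : int :=
  \sum_(i < d) tnth h i * tnth k i.

Definition zrdot (R : realType) (d : nat) (h : d.-tuple int)
    (x : d.-tuple R) : R :=
  \sum_(i < d) (tnth h i)%:~R * tnth x i.

Definition character (R : realType) (d : nat) (h : d.-tuple int)
    (x : d.-tuple R) : R[i] :=
  expi (2 * pi * zrdot h x).

Definition cintegral (R : realType) (d : nat) (g : d.-tuple R -> R[i]) : R[i] :=
  Complex (\int[torus_measure R d]_(x in @torus R d) complex.Re (g x))
          (\int[torus_measure R d]_(x in @torus R d) complex.Im (g x)).

Definition in_L1 (R : realType) (d : nat) (f : d.-tuple R -> R[i]) : Prop :=
  [/\ measurable_fun (@torus R d)
        ((fun x => complex.Re (f x)) : d.-tuple (measurableTypeR R) -> R),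
      measurable_fun (@torus R d)
        ((fun x => complex.Im (f x)) : d.-tuple (measurableTypeR R) -> R) &
      (\int[torus_measure R d]_(x in @torus R d) (cabs (f x))%:E < +oo)%E].

Definition Linf_norm (R : realType) (d : nat) (f : d.-tuple R -> R[i]) : \bar R :=
  Lnorm (torus_measure R d) +oo%E (fun x => (cabs (f x))%:E).

Definition fourier_coef (R : realType) (d : nat) (f : d.-tuple R -> R[i])
    (h : d.-tuple int) : R[i] :=
  cintegral (fun x => f x * expi (- (2 * pi * zrdot h x))).

Definition Hnorm (R : realType) (d : nat) (r : d.-tuple int -> R)
    (f : d.-tuple R -> R[i]) : \bar R :=
  sqrte (\esum_(h in [set: d.-tuple int])
           (r h * cabs (fourier_coef f h) ^+ 2)%:E).

(* The continuous representative is the one that is pointwise equal to its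
   Fourier series; sums over Z^d are unconditional, i.e. limits along the
   directed set of finite subsets of Z^d. *)
Definition is_continuous_representative (R : realType) (d : nat)
    (f : d.-tuple R -> R[i]) : Prop :=
  forall x, @torus R d x ->
    partial_sum (fun h => fourier_coef f h * character h x : R[i]^o)
      @ totally --> (f x : R[i]^o).

(* Elements of the reproducing kernel Hilbert space are functions, not classes
   modulo a.e. equality: each class is given by its continuous
   representative. *)
Definition Hspace (R : realType) (d : nat) (r : d.-tuple int -> R) :
    set (d.-tuple R -> R[i]) :=
  [set f | [/\ in_L1 f, (Hnorm r f < +oo)%E & is_continuous_representative f]].

Section MultipleRank1Lattice.
Variables (d L : nat) (I : set (d.-tuple int)).
Variables (z : 'I_L -> d.-tuple int) (M : 'I_L -> nat).

Definition lattice_node (R : realType) (l : 'I_L) (j : nat) : d.-tuple R :=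
  [tuple let t := j%:R * (tnth (z l) i)%:~R / (M l)%:R in
         t - (Num.floor t)%:~R | i < d].

Definition alias_free (l : 'I_L) : set (d.-tuple int) :=
  [set h | forall k, I k -> k <> h ->
     (zdot h (z l) != zdot k (z l) %[mod (M l)%:Z])%Z].

(* [covered n] is the union of the sets I_j with j < n, indices starting
   at 0 *)
Fixpoint covered (n : nat) : set (d.-tuple int) :=
  if n is m.+1 then
    covered m `|`
    \bigcup_(l in [set l : 'I_L | l = m :> nat])
      ((I `\` covered m) `&` alias_free l)
  else set0.

Definition level (l : 'I_L) : set (d.-tuple int) :=
  (I `\` covered l) `&` alias_free l.

Lemma levelE (l : 'I_L) :
  level l = [set h | (I `\` \bigcup_(j in [set j : 'I_L | (j < l)%N]) level j) h
                     /\ alias_free l h].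
Proof.
suff cE n : covered n = \bigcup_(j in [set j : 'I_L | (j < n)%N]) level j.
  by rewrite /level cE.
elim: n => [|n IHn] /=.
  by rewrite (_ : [set j | _] = set0) ?bigcup_set0// -subset0.
rewrite (_ : [set j : 'I_L | (j < n.+1)%N] =
  [set j : 'I_L | (j < n)%N] `|` [set j : 'I_L | j = n :> nat]).
  by rewrite bigcup_setU -IHn; congr setU; apply: eq_bigcupr => j /= <-.
apply/seteqP; split=> j /=; first by rewrite ltnS leq_eqVlt => /orP[/eqP|];
  [right|left].
by case=> [/ltnW|->]; rewrite ltnS.
Qed.

Definition lattice_coef (R : realType) (f : d.-tuple R -> R[i]) (l : 'I_L)
    (h : d.-tuple int) : R[i] :=
  ((M l)%:R)^-1 *
  \sum_(0 <= j < M l)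
    f (lattice_node R l j) *
    expi (- (2 * pi * j%:R * (zdot h (z l))%:~R / (M l)%:R)).

(* each [level l] has at most [M l] elements when 0 < M l, so the inner sum is
   finite *)
Definition lattice_approx (R : realType) (f : d.-tuple R -> R[i])
    (x : d.-tuple R) : R[i] :=
  \sum_(l < L) \sum_(h \in level l) lattice_coef f l h * character h x.

End MultipleRank1Lattice.

(* Main.v *)
Require Import Defs.
From mathcomp Require Import all_boot all_order all_algebra finmap.
From mathcomp Require Import all_classical all_reals all_analysis.
From mathcomp.analysis.showcase Require Import summability.
From mathcomp Require Import ring lra.
From mathcomp.real_closed Require Import complex.

Set Implicit Arguments.
Unset Strict Implicit.
Unset Printing Implicit Defensive.
Import Order.TTheory GRing.Theory Num.Theory.
Import numFieldNormedType.Exports.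
Local Open Scope classical_set_scope.
Local Open Scope ring_scope.

(** The error functional E_x f = f x - S f x, with S the lattice
    approximation, is a finite linear combination of values of f at points of
    the torus: the point x and the lattice nodes.  The values of f at such
    points are limits of the partial sums of its Fourier series, so E_x f is
    the limit, over the finite sets F of frequencies, of the sum over k in F of
    c_k E_x(e_k), where e_k is the character of frequency k.  It is therefore
    enough to know E_x on characters and to bound these finite sums.

    A rank-1 lattice rule applied to e_k at frequency h gives 1 if k and h
    alias, that is h.z = k.z modulo M, and 0 otherwise
    ([lattice_coef_character]).  On I_l the frequencies are pairwise
    non-aliasing, so the l-th layer of S e_k is either 0 or a single character.
    - If k is in I, then k lies in exactly one I_l, and the frequencies in the
      other layers do not alias with it, so S e_k = e_k and E_x(e_k) = 0
      ([lattice_approx_character]).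
    - Otherwise each of the L layers contributes modulus at most 1, so that
      |E_x(e_k)| <= L + 1 ([cabs_lattice_approx_character]).

    Hence the sum over F has modulus at most (L + 1) times the sum of |c_k|
    over k in F outside I.  By the Cauchy-Schwarz inequality with weights r and
    1/r ([sum_le_weighted]) and because f has norm at most 1, this is at most
    (L + 1) sqrt(sum of 1/r over the complement of I), uniformly in F.

    The resulting pointwise bound holds on [0,1)^d only, which suffices since
    the torus measure gives mass 0 to the complement ([ae_torus]). *)

(** * Complex exponentials *)

Lemma expiD (R : realType) (s t : R) : expi (s + t) = expi s * expi t.
Proof.
rewrite /expi cosD sinD; apply/eqP; rewrite eq_complex /= eqxx /=.
by apply/eqP; rewrite addrC.
Qed.

Lemma expi0 (R : realType) : expi (0 : R) = 1.
Proof. by rewrite /expi cos0 sin0. Qed.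

Lemma expiMn (R : realType) (t : R) n : expi (t *+ n) = expi t ^+ n.
Proof.
elim: n => [|n IHn]; first by rewrite mulr0n expi0.
by rewrite mulrS expiD IHn exprS.
Qed.

Lemma expi_2piz (R : realType) (n : int) : expi (2 * pi * n%:~R : R) = 1.
Proof.
have nat1 m : expi (2 * pi * m%:R : R) = 1.
  rewrite mulr_natr expiMn /expi mulrC mulr_natr cos2pi sin2pi.
  exact: expr1n.
case: n => m; first exact: nat1.
have e1 := nat1 m.+1; rewrite -[LHS]mulr1 -[in LHS]e1 -expiD.
by rewrite NegzE mulrNz mulrN addNr expi0.
Qed.

(** From the duplication formula, cos (2 pi t) = 1 - 2 sin^2 (pi t), and
    sin (pi t) > 0 on this range. *)
Lemma expi_neq1 (R : realType) (t : R) : 0 < t < 1 -> expi (2 * pi * t) != 1.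
Proof.
move=> /andP[t0 t1]; apply/eqP => -[cos1 _].
have s0 : 0 < sin (pi * t).
  by apply: sin_gt0_pi; rewrite mulr_gt0 ?pi_gt0//= gtr_pMr ?pi_gt0.
have := mulr_gt0 s0 s0; rewrite -expr2 sin2cos2.
move: cos1; have -> : 2 * pi * t = (pi * t) *+ 2 by rewrite mulr2n; ring.
by rewrite cos_mulr2n mulr2n; lra.
Qed.

Lemma cabs_expi (R : realType) (t : R) : cabs (expi t) = 1.
Proof. by rewrite /cabs /expi /= cos2Dsin2 sqrtr1. Qed.

Lemma cabsM (R : realType) (v w : R[i]) : cabs (v * w) = cabs v * cabs w.
Proof. exact: Normc.normcM. Qed.

Lemma cabs_ge0 (R : realType) (w : R[i]) : 0 <= cabs w.
Proof. by case: w => a b; exact: sqrtr_ge0. Qed.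

Lemma le_cabsD (R : realType) (v w : R[i]) : cabs (v + w) <= cabs v + cabs w.
Proof. exact: le_normcD. Qed.

Lemma cabs0 (R : realType) : cabs (0 : R[i]) = 0.
Proof. exact: Normc.normc0. Qed.

Lemma cabsN (R : realType) (w : R[i]) : cabs (- w) = cabs w.
Proof. exact: normcN. Qed.

Lemma normE_cabs (R : realType) (w : R[i]) : `|w| = (cabs w)%:C%C.
Proof. by case: w. Qed.

Lemma le_cabs_sum (R : realType) (J : Type) (s : seq J) (P : pred J)
    (g : J -> R[i]) :
  cabs (\sum_(j <- s | P j) g j) <= \sum_(j <- s | P j) cabs (g j).
Proof.
elim/big_ind2 : _ => [|x1 x2 y1 y2 H1 H2|//]; first by rewrite cabs0.
by rewrite (le_trans (le_cabsD _ _))// lerD.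
Qed.

(** * Cauchy-Schwarz inequality and weighted sums *)

Lemma sum_cauchy_schwarz (R : rcfType) (J : Type) (s : seq J) (P : pred J)
    (a b : J -> R) :
  \sum_(j <- s | P j) a j * b j <=
    Num.sqrt (\sum_(j <- s | P j) a j ^+ 2) *
    Num.sqrt (\sum_(j <- s | P j) b j ^+ 2).
Proof.
have sq_ge0 (c : J -> R) s' : 0 <= \sum_(j <- s' | P j) c j ^+ 2.
  by apply: sumr_ge0 => j _; exact: sqr_ge0.
(* The induction step is the two-dimensional inequality
   a b + p q <= sqrt (a^2 + p^2) sqrt (b^2 + q^2), where p and q are the norms
   of the tails; the gap between the squares is (a q - b p)^2. *)
elim: s => [|j s IHs]; first by rewrite !big_nil sqrtr0 mul0r.
rewrite !big_cons; case: ifP => // _; apply: (le_trans (lerD (lexx _) IHs)).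
rewrite -{2}[\sum_(k <- s | P k) a k ^+ 2]sqr_sqrtr//.
rewrite -{2}[\sum_(k <- s | P k) b k ^+ 2]sqr_sqrtr//.
set p := Num.sqrt _; set q := Num.sqrt _.
rewrite -sqrtrM ?addr_ge0 ?sqr_ge0//; apply: (le_trans (ler_norm _)).
rewrite -sqrtr_sqr; apply: ler_wsqrtr; rewrite -subr_ge0.
apply: (@le_trans _ _ ((a j * q - b j * p) ^+ 2)); first exact: sqr_ge0.
by rewrite le_eqVlt; apply/orP; left; apply/eqP; ring.
Qed.

Lemma sum_le_esum (R : realType) (T : choiceType) (S : set T) (a : T -> R)
    (F : {fset T}) : (forall k, 0 <= a k) ->
  ((\sum_(k <- F | k \in S) a k)%:E <= \esum_(k in S) (a k)%:E)%E.
Proof.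
move=> a0; apply: esum_ge; exists [set` [fset k in F | k \in S]%fset].
  by split => [|k /=]; [exact: finite_fset|rewrite !inE => /andP[_ /set_mem]].
by rewrite fsbig_finite ?finite_fset//= set_fsetK big_fset/= sumEFin.
Qed.

Lemma sqrte_le1 (R : realType) (a : \bar R) :
  (sqrte a <= 1)%E -> (a <= 1)%E.
Proof. by have := lee_sqrt a (@lee01 R); rewrite [sqrte 1]/= sqrtr1 => ->. Qed.

(** Cauchy-Schwarz for c = r^(-1/2) (r^(1/2) c).  The first factor is summed over
    [S] only, whereas the norm of [c] may be taken over the whole of [T]; this is
    how the tail over the complement of I appears in the error bound. *)
Lemma sum_le_weighted (R : realType) (T : choiceType) (r c : T -> R)
    (S : set T) (F : {fset T}) (A : R) :
  (forall k, 0 < r k) -> (\esum_(k in S) ((r k)^-1)%:E = A%:E)%E ->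
  (\esum_(k in [set: T]) (r k * c k ^+ 2)%:E <= 1)%E ->
  \sum_(k <- F | k \in S) c k <= Num.sqrt A.
Proof.
move=> r0 rA rc1; have w0 k : 0 <= r k := ltW (r0 k).
pose a k := Num.sqrt (r k)^-1; pose b k := Num.sqrt (r k) * c k.
have cE k : c k = a k * b k.
  by rewrite /a /b mulrA -sqrtrM ?invr_ge0// mulVf ?gt_eqF// sqrtr1 mul1r.
have a2 k : a k ^+ 2 = (r k)^-1 by rewrite sqr_sqrtr ?invr_ge0.
have b2 k : b k ^+ 2 = r k * c k ^+ 2 by rewrite exprMn sqr_sqrtr.
under eq_bigr do rewrite cE.
apply: (le_trans (sum_cauchy_schwarz _ _ _ _)).
under eq_bigr do rewrite a2.
under [X in _ * Num.sqrt X]eq_bigr do rewrite b2.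
rewrite -[leRHS]mulr1; apply: ler_pM; rewrite ?sqrtr_ge0//.
  apply: ler_wsqrtr; rewrite -lee_fin -rA.
  by apply: sum_le_esum => k; rewrite invr_ge0.
rewrite -[leRHS]sqrtr1; apply: ler_wsqrtr; rewrite -lee_fin.
have rc0 k : 0 <= r k * c k ^+ 2 by rewrite mulr_ge0// sqr_ge0.
apply: le_trans rc1; apply: (le_trans _ (@sum_le_esum R T setT _ F rc0)).
rewrite lee_fin [leRHS](eq_bigl predT) => [|k]; last exact: in_setT.
by rewrite [leRHS](bigID (mem S)) lerDl sumr_ge0.
Qed.

(** * Aliasing on a rank-1 lattice *)

(** Orthogonality of the characters of Z/M: unless m is divisible by M, this is
    a geometric sum whose ratio is an M-th root of unity other than 1. *)
Lemma sum_expi (R : realType) (m : int) (M : nat) : (0 < M)%N ->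
  \sum_(0 <= j < M) expi (2 * pi * (m%:~R / M%:R) *+ j : R) =
  if (M%:Z %| m)%Z then M%:R else 0.
Proof.
move=> M_gt0; have M0 : M%:R != 0 :> R by rewrite pnatr_eq0 -lt0n.
rewrite big_mkord; under eq_bigr do rewrite expiMn.
have [/dvdzP[q ->]|Mm] := boolP (M%:Z %| m)%Z.
  rewrite intrM mulfK// expi_2piz.
  by under eq_bigr do rewrite expr1n; rewrite sumr_const card_ord.
set w := expi _; have wM : w ^+ M = 1.
  by rewrite -expiMn -[_ *+ M]mulr_natr -[_ * M%:R]mulrA divfK// expi_2piz.
have w1 : w != 1.
  have -> : w = expi (2 * pi * ((m %% M)%Z%:~R / M%:R)).
    rewrite /w {1}(divz_eq m M) intrD intrM [_ / M%:R]mulrDl mulfK// mulrDr.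
    by rewrite expiD expi_2piz mul1r.
  apply: expi_neq1.
  have M0z : M%:Z != 0 by rewrite eqz_nat -lt0n.
  rewrite ltr_pdivrMr ?ltr0n// mul1r -[M%:R]/(M%:Z%:~R) ltr_int ltz_pmod//.
  rewrite andbT divr_gt0 ?ltr0n ?ltr0z// lt_def modz_ge0// andbT.
  by apply: contra Mm => /eqP/dvdz_mod0P.
apply/eqP; move: (subrX1 w M); rewrite wM subrr => /esym/eqP.
by rewrite mulf_eq0 subr_eq0 (negPf w1).
Qed.

(** Reducing the node modulo 1 shifts the phase by an integer, so that only
    k.z / M is left of the d-dimensional frequency. *)
Lemma character_lattice_node (R : realType) (d L : nat)
    (z : 'I_L -> d.-tuple int) (M : 'I_L -> nat) (k : d.-tuple int) l j :
  character k (lattice_node z M R l j) =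
  expi (2 * pi * ((zdot k (z l))%:~R / (M l)%:R) *+ j).
Proof.
pose t i : R := j%:R * (tnth (z l) i)%:~R / (M l)%:R.
rewrite /character; have -> : zrdot k (lattice_node z M R l j) =
    j%:R * ((zdot k (z l))%:~R / (M l)%:R) +
    (- \sum_(i < d) tnth k i * Num.floor (t i))%:~R.
  rewrite /zrdot /zdot mulrNz !rmorph_sum/= mulr_suml mulr_sumr -sumrB.
  by apply: eq_bigr => i _; rewrite tnth_mktuple/= -/(t i) !intrM /t; ring.
rewrite mulrDr expiD expi_2piz mulr1 -mulr_natl.
by congr expi; ring.
Qed.

(** The mean over the M nodes of e_k times the conjugate of e_h is the mean over
    j of e^(2 pi i j m / M) with m = (k - h).z, to which orthogonality applies. *)
Lemma lattice_coef_character (R : realType) (d L : nat)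
    (z : 'I_L -> d.-tuple int) (M : 'I_L -> nat) (h k : d.-tuple int) l :
  (0 < M l)%N ->
  lattice_coef z M (@character R d k) l h =
  (zdot h (z l) == zdot k (z l) %[mod (M l)%:Z])%Z%:R.
Proof.
move=> M_gt0; rewrite /lattice_coef.
under eq_bigr => j _.
  rewrite character_lattice_node -expiD.
  rewrite (_ : _ - _ = 2 * pi *
      ((zdot k (z l) - zdot h (z l))%:~R / (M l)%:R) *+ j); last first.
    by rewrite -[RHS]mulr_natr intrB; ring.
  over.
rewrite sum_expi// eq_sym eqz_mod_dvd; case: ifP => _; last by rewrite mulr0.
by rewrite mulVf// pnatr_eq0 -lt0n.
Qed.

(** * Levels of a multiple rank-1 lattice *)

Section levels.
Variables (d L : nat) (I : set (d.-tuple int)).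
Variables (z : 'I_L -> d.-tuple int) (M : 'I_L -> nat).
Implicit Types (h k : d.-tuple int) (l : 'I_L).

Lemma level_sub l : level I z M l `<=` I.
Proof. by move=> h [[]]. Qed.

Lemma level_alias l h k : level I z M l h -> I k ->
  (zdot h (z l) == zdot k (z l) %[mod (M l)%:Z])%Z -> h = k.
Proof.
move=> [_ af] Ik hk; apply: contrapT => hNk.
by have /negP := af k Ik (fun e => hNk (esym e)); apply.
Qed.

Lemma level_inj l : {in level I z M l &, injective
   (fun h => zdot h (z l) %% (M l)%:Z)%Z}.
Proof.
move=> h k; rewrite !inE => lh /level_sub Ik hk.
by apply: (level_alias lh Ik); apply/eqP.
Qed.

(** Distinct elements of a level have distinct residues modulo [M l].
    Finiteness is what gives the sum over a level its meaning: by convention, a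
    sum over a set is 0 when its support is infinite. *)
Lemma finite_level l : (0 < M l)%N -> finite_set (level I z M l).
Proof.
move=> M_gt0.
rewrite -(eq_finite_set (inj_card_eq (@level_inj l))).
apply: (@sub_finite_set _ _ (Posz @` `I_(M l)));
  last exact/finite_image/finite_II.
move=> _ [h _ <-]; exists `|(zdot h (z l) %% (M l)%:Z)%Z|%N => /=.
  by rewrite -ltz_nat gez0_abs ?ltz_pmod ?modz_ge0//; case: (M l) M_gt0.
by rewrite gez0_abs// modz_ge0//; case: (M l) M_gt0.
Qed.

Lemma level_disjoint l1 l2 k : level I z M l1 k -> level I z M l2 k -> l1 = l2.
Proof.
wlog : l1 l2 / (l1 <= l2)%N => [hw|].
  by case/orP: (leq_total l1 l2) => ? ? ?; [|apply/esym]; exact: hw.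
rewrite leq_eqVlt => /predU1P[/val_inj//|l12] k1.
by rewrite levelE => -[[_ /=]] []; exists l1.
Qed.

End levels.

(** * Limits of complex-valued functions *)

Lemma cvg_bigsum (R : realType) (T J : Type) (F : set_system T)
    (FF : Filter F) (s : seq J) (u : J -> T -> R[i]) (a : J -> R[i]) :
  (forall j, u j t @[t --> F] --> (a j : R[i]^o)) ->
  (\sum_(j <- s) u j t : R[i]^o) @[t --> F] --> (\sum_(j <- s) a j : R[i]^o).
Proof.
move=> ua; elim: s => [|j s IHs].
  by rewrite big_nil; under eq_fun do rewrite big_nil; exact: cvg_cst.
rewrite big_cons; under eq_fun do rewrite big_cons.
exact: (@cvgD _ (R[i]^o)).
Qed.

Lemma cvg_mulr_cst (R : realType) (T : Type) (F : set_system T) (FF : Filter F)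
    (u : T -> R[i]) (a c : R[i]) :
  u t @[t --> F] --> (a : R[i]^o) ->
  (u t * c : R[i]^o) @[t --> F] --> (a * c : R[i]^o).
Proof.
move=> ua; rewrite mulrC; under eq_fun do rewrite mulrC.
exact: (@cvgZl_tmp _ (R[i]^o)).
Qed.

(** * The approximation operator on characters and on limits *)

Section approximation_error.
Variables (R : realType) (d L : nat) (I : set (d.-tuple int)).
Variables (z : 'I_L -> d.-tuple int) (M : 'I_L -> nat).
Hypothesis M_gt0 : forall l, (0 < M l)%N.
Implicit Types (h k : d.-tuple int) (l : 'I_L) (x : d.-tuple R).
Implicit Types (f : d.-tuple R -> R[i]).

Lemma lattice_approxE f x : lattice_approx I z M f x =
  \sum_(l < L) \sum_(h <- fset_set (level I z M l))
    lattice_coef z M f l h * character h x.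
Proof.
by apply: eq_bigr => l _; rewrite fsbig_finite//; exact: finite_level.
Qed.

Let layer k l x := \sum_(h <- fset_set (level I z M l))
  lattice_coef z M (@character R d k) l h * character h x.

(** A level contains no two frequencies with the same residue, so at most one
    term survives in a layer. *)
Let layer_alias k l x h : level I z M l h ->
  (zdot h (z l) == zdot k (z l) %[mod (M l)%:Z])%Z ->
  layer k l x = character h x.
Proof.
move=> lh hk; have fl := @finite_level _ _ I z M l (M_gt0 l).
rewrite /layer (bigD1_seq h) ?fset_uniq ?in_fset_set ?mem_set//=.
rewrite lattice_coef_character// hk mul1r big_seq_cond big1 ?addr0// => h'.
rewrite in_fset_set// => /andP[/set_mem lh' h'h].
rewrite lattice_coef_character//; case: eqP => [h'k|]; last by rewrite mul0r.
have hh' : (zdot h' (z l) == zdot h (z l) %[mod (M l)%:Z])%Z.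
  by rewrite h'k eq_sym.
by rewrite (level_alias lh' (level_sub lh) hh') eqxx in h'h.
Qed.

Let layer_no_alias k l x : (forall h, level I z M l h ->
    (zdot h (z l) != zdot k (z l) %[mod (M l)%:Z])%Z) ->
  layer k l x = 0.
Proof.
move=> noalias; have fl := @finite_level _ _ I z M l (M_gt0 l).
rewrite /layer big_seq big1// => h; rewrite in_fset_set// => /set_mem lh.
by rewrite lattice_coef_character// (negPf (noalias h lh)) mul0r.
Qed.

(** A frequency of I aliases with no other frequency of any level, since the
    levels are alias-free with respect to the whole of I; the layers not
    containing it vanish. *)
Lemma lattice_approx_character k x : (exists l, level I z M l k) ->
  lattice_approx I z M (character k) x = character k x.
Proof.
move=> [l lk]; rewrite lattice_approxE (bigD1 l)//=.
rewrite -/(layer k l x) (layer_alias x lk)// big1 ?addr0// => l' l'l.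
apply: layer_no_alias => h l'h; apply/negP => hk.
have ekh := level_alias l'h (level_sub lk) hk; move: l'h; rewrite ekh => l'k.
by rewrite (level_disjoint lk l'k) eqxx in l'l.
Qed.

Lemma cabs_lattice_approx_character k x :
  cabs (lattice_approx I z M (character k) x) <= L%:R.
Proof.
rewrite lattice_approxE (le_trans (le_cabs_sum _ _ _))//.
rewrite -[leRHS]mulr1 mulr_natl -[L in _ *+ L]card_ord -sumr_const.
apply: ler_sum => l _; rewrite -/(layer k l x).
have [[h [lh hk]]|noh] := pselect (exists h, level I z M l h /\
    (zdot h (z l) == zdot k (z l) %[mod (M l)%:Z])%Z).
  by rewrite (layer_alias x lh hk) /character cabs_expi.
rewrite layer_no_alias ?cabs0 ?ler01// => h lh; apply/negP => hk.
by apply: noh; exists h.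
Qed.

Lemma lattice_coef_sum (J : Type) (s : seq J) (c : J -> R[i])
    (g : J -> d.-tuple R -> R[i]) l h :
  lattice_coef z M (fun y => \sum_(k <- s) c k * g k y) l h =
  \sum_(k <- s) c k * lattice_coef z M (g k) l h.
Proof.
rewrite /lattice_coef; under eq_bigr do rewrite mulr_suml.
rewrite exchange_big mulr_sumr; apply: eq_bigr => k _.
rewrite mulrCA; congr (_ * _); rewrite mulr_sumr.
by apply: eq_bigr => j _; rewrite mulrA.
Qed.

Lemma lattice_approx_sum (J : Type) (s : seq J) (c : J -> R[i])
    (g : J -> d.-tuple R -> R[i]) x :
  lattice_approx I z M (fun y => \sum_(k <- s) c k * g k y) x =
  \sum_(k <- s) c k * lattice_approx I z M (g k) x.
Proof.
rewrite lattice_approxE; under eq_bigr => l _.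
  under eq_bigr do rewrite lattice_coef_sum mulr_suml.
  rewrite exchange_big; over.
rewrite exchange_big /=; apply: eq_bigr => k _.
rewrite lattice_approxE mulr_sumr; apply: eq_bigr => l _.
by rewrite mulr_sumr; apply: eq_bigr => h _; rewrite mulrA.
Qed.

(** The continuous representative is specified on the torus only, so its Fourier
    series may be used at the nodes because they are reduced modulo 1. *)
Lemma torus_lattice_node l j : torus (lattice_node z M R l j).
Proof.
move=> i; rewrite tnth_mktuple subr_ge0 floor_le/= ltrBlDl.
by rewrite -[1]/(1%:~R) -intrD lt_succ_floor.
Qed.

(** For fixed [x] the approximation depends on finitely many values of its
    argument, so it commutes with pointwise limits on the torus. *)
Lemma cvg_lattice_approx (T : Type) (F : set_system T) (FF : Filter F)
    (u : T -> d.-tuple R -> R[i]) f x :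
  (forall y, torus y -> u t y @[t --> F] --> (f y : R[i]^o)) ->
  lattice_approx I z M (u t) x @[t --> F] -->
    (lattice_approx I z M f x : R[i]^o).
Proof.
move=> uf; rewrite lattice_approxE; under eq_fun do rewrite lattice_approxE.
apply: cvg_bigsum => l; apply: cvg_bigsum => h; apply: cvg_mulr_cst.
rewrite /lattice_coef [_^-1 * _]mulrC; under eq_fun do rewrite [_^-1 * _]mulrC.
apply: cvg_mulr_cst; apply: cvg_bigsum => j; apply: cvg_mulr_cst.
exact/uf/torus_lattice_node.
Qed.

End approximation_error.

(** * The torus has full measure *)

Lemma measurable_torus (R : realType) (d : nat) :
  measurable (@torus R d : set (d.-tuple (measurableTypeR R))).
Proof.
rewrite (_ : @torus R d = \bigcap_(i in [set: 'I_d])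
    ((fun x : d.-tuple (measurableTypeR R) => tnth x i) @^-1` `[0, 1[%classic)).
  apply: fin_bigcap_measurable => [|i _]; first exact: finite_finset.
  by rewrite -[X in measurable X]setTI; exact: measurable_tnth.
apply/seteqP; split => x /= tx i.
  by move=> _ /=; rewrite in_itv/=; exact: tx.
by have := tx i Logic.I; rewrite /= in_itv.
Qed.

Lemma torus_measure_torus (R : realType) (d : nat) :
  torus_measure R d (@torus R d) = 1%E.
Proof.
elim: d => [|d IHd] /=.
  by rewrite diracE mem_set// => -[].
rewrite /distribution /pushforward.
rewrite (_ : _ @^-1` _ = `[0, 1[%classic `*` @torus R d).
  rewrite /product_probability product_measure1E//;
    last exact: measurable_torus.
  apply: etrans (congr1 (mule _) IHd) _; rewrite mule1.
  rewrite -[LHS]/(@torus_measure1 R `[0, 1[%classic).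
  by rewrite -(torus_measure1_setT R) /torus_measure1 /mrestr setIid setTI.
apply/seteqP; split => -[a x] /=.
  move=> tx; split => [|i]; first by have := tx ord0; rewrite tnth0 in_itv.
  by have := tx (lift ord0 i); rewrite tnthS.
rewrite in_itv /= => -[a01 tx] i.
by case: (unliftP ord0 i) => [j|] ->; rewrite ?tnth0 ?tnthS; [exact: tx|].
Qed.

Lemma ae_torus (R : realType) (d : nat) :
  {ae torus_measure R d, forall x, @torus R d x}.
Proof.
have mT := @measurable_torus R d.
exists (~` @torus R d); split => //; first exact: measurableC.
by rewrite probability_setC// torus_measure_torus subee.
Qed.

Lemma Linf_norm_le (R : realType) (d : nat) (g : d.-tuple R -> R[i]) (b : R) :
  (forall x, torus x -> cabs (g x) <= b) -> (Linf_norm g <= b%:E)%E.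
Proof.
move=> gb; rewrite /Linf_norm unlock ifT; last first.
  by have := @lte01 R; rewrite -(probability_setT (torus_measure R d)).
have [N [mN N0 torusN]] := @ae_torus R d.
apply/ess_sup_inf.ess_supP; exists N; split => // x /= gxb.
apply: torusN => tx; apply: gxb.
by rewrite lee_fin ger0_norm ?cabs_ge0// gb.
Qed.

(** * The error bound *)

Lemma cabs_approx_error_character (R : realType) (d L : nat)
    (I : set (d.-tuple int)) (z : 'I_L -> d.-tuple int) (M : 'I_L -> nat)
    (k : d.-tuple int) (x : d.-tuple R) :
  (forall l, (0 < M l)%N) -> I = \bigcup_(l in [set: 'I_L]) level I z M l ->
  cabs (character k x - lattice_approx I z M (character k) x) <=
  if k \in ~` I then L.+1%:R else 0.
Proof.
move=> M_gt0 I_union; rewrite in_setC.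
have [|_] := boolP (k \in I).
  rewrite inE I_union => -[l _]; rewrite -I_union => lk.
  by rewrite lattice_approx_character ?subrr ?cabs0//; exists l.
rewrite (le_trans (le_cabsD _ _))// cabsN cabs_expi -natr1 addrC lerD2r.
exact: cabs_lattice_approx_character.
Qed.

(** The bound is proved on the partial sums of the Fourier series, where it is
    uniform in the finite set of frequencies, and passed to the limit. *)
Lemma approx_error_bound (R : realType) (d : nat) (r : d.-tuple int -> R)
    (I : set (d.-tuple int)) (L : nat) (z : 'I_L -> d.-tuple int)
    (M : 'I_L -> nat) (A : R) (f : d.-tuple R -> R[i]) (x : d.-tuple R) :
  (forall h, 0 < r h) -> (\esum_(h in ~` I) ((r h)^-1)%:E = A%:E)%E ->
  (forall l, (0 < M l)%N) -> I = \bigcup_(l in [set: 'I_L]) level I z M l ->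
  (Hnorm r f <= 1)%E -> is_continuous_representative f -> torus x ->
  cabs (f x - lattice_approx I z M f x) <= L.+1%:R * Num.sqrt A.
Proof.
move=> r0 rA M_gt0 I_union /sqrte_le1 f1 f_cvg tx.
pose P (F : {fset d.-tuple int}) (y : d.-tuple R) :=
  \sum_(k <- F) fourier_coef f k * character k y.
have P_cvg y : torus y -> P F y @[F --> totally] --> (f y : R[i]^o).
  move=> ty; rewrite (_ : P^~ y = partial_sum
    (fun h => fourier_coef f h * character h y : R[i]^o)); first exact: f_cvg.
  by apply/funext => F; rewrite /P big_seq_fsetE.
have FF := @totally_filter (d.-tuple int).
have E_cvg :
    (P F x - lattice_approx I z M (P F) x : R[i]^o) @[F --> totally] -->
    (f x - lattice_approx I z M f x : R[i]^o).
  by apply: cvgB; [exact: P_cvg|exact: cvg_lattice_approx].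
have E_le F : cabs (P F x - lattice_approx I z M (P F) x) <=
    L.+1%:R * Num.sqrt A.
  rewrite lattice_approx_sum// -sumrB (le_trans (le_cabs_sum _ _ _))//.
  apply: (@le_trans _ _ (\sum_(k <- F)
      cabs (fourier_coef f k) * (if k \in ~` I then L.+1%:R else 0))).
    apply: ler_sum => k _; rewrite -mulrBr cabsM ler_wpM2l ?cabs_ge0//.
    exact: cabs_approx_error_character.
  under eq_bigr do rewrite mulrC (fun_if ( *%R^~ _)) mul0r.
  rewrite -big_mkcond -mulr_sumr ler_wpM2l ?ler0n//.
  exact: (sum_le_weighted F r0 rA f1).
apply/ler_addgt0Pr => e e0.
have eC : 0 < e%:C%C by rewrite ltcR.
have [F] := filter_ex (cvgr_dist_le _ _ E_cvg _ eC).
rewrite normE_cabs lecR => dist.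
rewrite -[X in cabs X](subrK (P F x - lattice_approx I z M (P F) x)).
by rewrite (le_trans (le_cabsD _ _))// addrC lerD.
Qed.

Theorem theorem3p5 (R : realType) (d : nat) (r : d.-tuple int -> R)
  (I : set (d.-tuple int)) (L : nat)
  (z : 'I_L -> d.-tuple int) (M : 'I_L -> nat)
  (d_gt0 : (0 < d)%N)
  (r_gt0 : forall h, 0 < r h)
  (r_sum : (\esum_(h in [set: d.-tuple int]) ((r h)^-1)%:E < +oo)%E)
  (L_gt0 : (0 < L)%N)
  (M_gt0 : forall l, (0 < M l)%N)
  (I_union : I = \bigcup_(l in [set: 'I_L]) level I z M l) :
  (ereal_sup
     [set Linf_norm (fun x => f x - lattice_approx I z M f x)%R |
        f in [set f | Hspace r f /\ Hnorm r f <= 1]]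
   <= (L.+1%:R)%:E * sqrte (\esum_(h in ~` I) ((r h)^-1)%:E))%E.
Proof.
have w0 h : (0 <= ((r h)^-1)%:E)%E by rewrite lee_fin invr_ge0 ltW.
have tail0 : (0 <= \esum_(h in ~` I) ((r h)^-1)%:E)%E by exact: esum_ge0.
have tailE : (\esum_(h in ~` I) ((r h)^-1)%:E =
    (fine (\esum_(h in ~` I) ((r h)^-1)%:E))%:E)%E.
  rewrite fineK// ge0_fin_numE// (le_lt_trans _ r_sum)//.
  rewrite (esumID (~` I) setT)// setTI leeDl//; exact: esum_ge0.
apply: ge_ereal_sup => _ [f [[_ _ f_cvg] f1] <-].
rewrite tailE -EFinM; apply: Linf_norm_le => x tx.
exact: approx_error_bound tailE _ _ _ _ _.
Qed.
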